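(* Let $k\ge 0$ be a fixed integer, let $D=\left\lfloor\frac{1+\sqrt{1+8k}}{2}\right\rfloor$, and let $p=p(n)$ be such that $$\frac{(\log n)^{2D}\log\log n}{n}\ll p\ll 1 .$$ Let $R$ be a random subset of the cyclic group $C_n$ obtained by choosing each element of $C_n$ independently with probability $p$, and let $N^R_{n-1-k}$ be the number of zero-sum free sequences of length $n-1-k$ contained in $R$. Then, asymptotically almost surely, $$N^R_{n-1-k}=p\,\varphi(n)+O_k\left(p^2\varphi(n)+\sqrt{p\,\varphi(n)}\,(\log n)^D\right),$$ where the constant in $O_k$ depends only on $k$ and $\varphi(n)$ denotes the number of generators of $C_n$.
   Context: $C_n$ is the cyclic group of order $n$, written additively. A sequence of length $\ell$ over $C_n$ is an unordered collection with repetition allowed (a multiset) $S=a_1\cdot a_2\cdot\ldots\cdot a_\ell$ of $\ell$ elements of $C_n$. A subsequence of $S$ is a sequence $T$ in which the multiplicity of each $a\in C_n$ is at most its multiplicity in $S$. $S$ is a zero-sum sequence if $a_1+\dots+a_\ell=0$, and $S$ is zero-sum free if it contains no (nonempty) zero-sum subsequence. $S$ is contained in $A\subset C_n$ if every element occurring in $S$ lies in $A$. For functions of $n$, $f\ll g$ (equivalently $g\gg f$) means $f/g\to0$ as $n\to\infty$. ''Asymptotically almost surely'' means with probability tending to $1$ as $n\to\infty$; a statement ''a.a.s. $X=a+O_k(b)$'' means that there is a constant $c_k$ depending only on $k$ such that $\Pr[|X-a|\le c_k b]\to1$ as $n\to\infty$. *)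

(* Defs.v *)
From mathcomp Require Export all_boot all_order all_algebra all_fingroup all_solvable.
From mathcomp Require Export all_classical all_reals all_analysis.

Set Implicit Arguments.
Unset Strict Implicit.
Unset Printing Implicit Defensive.

Import Order.TTheory GRing.Theory Num.Theory.
Import numFieldNormedType.Exports.

Local Open Scope ring_scope.
Local Open Scope classical_set_scope.

Section Sequences.
Variables (T : finZmodType) (l : nat).

(* A multiset is encoded by its multiplicity function. Bounding multiplicities
   by l loses nothing for multisets of length l and their submultisets, and
   makes the type finite. *)
Definition mseq := {ffun T -> 'I_l.+1}.

Implicit Types S U : mseq.

Definition mlength S : nat := \sum_(x : T) (S x : nat).

Definition msum S : T := \sum_(x : T) x *+ S x.

Definition subsequence U S : bool := [forall x, (U x <= S x)%N].

Definition zero_sum S : bool := msum S == 0.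

Definition zero_sum_free S : bool :=
  ~~ [exists U, [&& subsequence U S, (0 < mlength U)%N & zero_sum U]].

Definition contained_in S (A : {set T}) : bool :=
  [forall x, (0 < S x)%N ==> (x \in A)].

(* N^A_l *)
Definition num_zsf (A : {set T}) : nat :=
  #|[pred S : mseq | [&& mlength S == l, zero_sum_free S & contained_in S A]]|.

End Sequences.

Arguments num_zsf {T} l A.

(* Probability that the event E holds for a random subset of T containing each
   element independently with probability p. *)
Definition Pr_subset {R : realType} {T : finType} (p : R)
    (E : pred {set T}) : R :=
  \sum_(A : {set T} | E A) \prod_(x : T) (if x \in A then p else 1 - p).

(* Division by zero returns 0 here, so a quotient tending to 0 only has its
   usual meaning if the denominator is eventually nonzero. *)
Definition much_less {R : realType} (f g : nat -> R) : Prop :=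
  (\forall n \near \oo, g n != 0) /\ f n / g n @[n --> \oo] --> (0 : R).

(* 'Z_n is C_n for n >= 2 only ('Z_0 and 'Z_1 are Z/2Z); this is harmless in
   statements about n tending to infinity. *)
Definition phi (n : nat) : nat := #|[pred g : 'Z_n | generator [set: 'Z_n]%SET g]|.

Lemma phiE n : (1 < n)%N -> phi n = totient n.
Proof.
move=> n1; have := totient_gen (Zp1 : 'Z_n).
rewrite order_Zp1 Zp_cast // => ->.
by rewrite -Zp_cycle -cardsE; apply: eq_card => g; rewrite !inE.
Qed.

(* floor ((1 + sqrt (1 + 8 k)) / 2); Num.truncn is the floor on nonnegative
   numbers, valued in nat. *)
Definition Dk (R : realType) (k : nat) : nat :=
  Num.truncn ((1 + Num.sqrt (1 + 8 * k%:R)) / 2 : R).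

(* Main.v *)
(* A zero-sum free sequence S of length n - 1 - k has at most n subsums (counting
   the empty one). By the Moser-Scherk theorem, each of r disjoint pairs of
   distinct terms of S raises the number of subsums by 3 and every other term by
   1, so r <= k, and some g occurs at least n - 1 - 3k times in S. For large n
   this forces g to generate C_n, and writing the terms of S as c g with
   0 < c < n, the sum of these c stays below n. Hence S consists of g and of at
   most k terms among 2g, ..., (k+1)g. Consequently X <= N <= X + (k+1)^k Y, where
   X counts the generators g in R and Y the pairs (g, j), j < k, with g a
   generator and both g and (j+2)g in R. The means of X and Y are p phi(n) and
   k p^2 phi(n); both variances are O_k(p phi(n)), because a set {g, (j+2)g}
   meets only O_k(1) others, and Chebyshev's inequality concludes. *)
Require Import Defs.
From mathcomp Require Import zify ring lra.

Set Implicit Arguments.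
Unset Strict Implicit.
Unset Printing Implicit Defensive.

Import Order.TTheory GRing.Theory Num.Theory.
Import numFieldNormedType.Exports.
Local Open Scope ring_scope.

(** * The Moser-Scherk theorem and the number of subsums *)

Section ZeroSumFree.
Variable T : finZmodType.
Implicit Types (a b g x : T) (s t : seq T) (A B : {set T}).

(* Induction on #|B| with Dyson's e-transform: replace (A, B) by
   (A U (B + e), B /\ (A - e)) for some e in A with A - e not containing B. *)
Lemma moser_scherk A B :
  0 \in A -> 0 \in B ->
  (forall a b, a \in A -> b \in B -> a + b = 0 -> b = 0) ->
  (#|A| + #|B| <= #|[set (a + b)%R | a in A, b in B]|.+1)%N.
Proof.
have [m] := ubnP #|B|; elim: m A B => // m IHm A B leBm A0 B0 AB0.
have [B1 | /forall_inPn[b Bb bN0]] := boolP [forall b in B, b == 0].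
  have -> : B = [set 0].
    by apply/setP=> b; rewrite inE; apply/idP/eqP => [|-> //]; move/(forall_inP B1)/eqP.
  rewrite cards1 addn1 ltnS; apply/subset_leq_card/fintype.subsetP => a Aa.
  by apply/imset2P; exists a 0; rewrite ?inE ?addr0.
(* If no such [e] exists, [A] is stable under adding [b], so it contains every multiple of [b], in
   particular [-b]; then [-b + b = 0] and [AB0] give [b = 0]. *)
have [e Ae eb] : exists2 e, e \in A & e + b \notin A.
  apply/exists_inP; apply: contraNT bN0 => /exists_inPn Ab.
  have Ak k : b *+ k \in A.
    by elim: k => [|k IHk]; rewrite ?mulr0n // mulrSr; have := Ab _ IHk; rewrite negbK.
  have := AB0 (b *+ (#[b]%g).-1) b (Ak _) Bb.
  rewrite -mulrSr prednK ?order_gt0 // => -> //.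
  by rewrite -FinRing.zmodXgE expg_order.
pose A' := A :|: [set x + e | x in B]; pose B' := [set x in B | x + e \in A].
have B'B : (#|B'| < #|B|)%N.
  apply/proper_card/properP; split.
    by apply/fintype.subsetP=> x; rewrite inE => /andP[].
  by exists b; rewrite // inE Bb addrC.
(* [B' + e] is the intersection of [A] and [B + e], so this is inclusion-exclusion. *)
have cardE : (#|A'| + #|B'| = #|A| + #|B|)%N.
  rewrite -(card_imset (mem B) (addIr e)) -(card_imset (mem B') (addIr e)).
  rewrite -[RHS]cardsUI; congr (_ + #|pred_of_set _|)%N.
  apply/setP=> x; rewrite inE; apply/imsetP/andP => [[y]|[Ax /imsetP[y By xE]]].
    by rewrite inE => /andP[By Aye] ->; split; last exact: imset_f.
  by exists y => //; rewrite inE By -xE.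
rewrite -cardE; have /leq_trans-> // :
    (#|A'| + #|B'| <= #|[set (a + b)%R | a in A', b in B']|.+1)%N.
  apply: IHm; first exact: leq_trans B'B leBm.
  - by rewrite inE A0.
  - by rewrite inE B0 add0r.
  - move=> x y; rewrite !inE => /orP[Ax|/imsetP[z Bz ->]] /andP[By Aye].
      exact: AB0.
    move=> zey; have z0 : z = 0.
      by apply: (AB0 _ _ Aye Bz); rewrite -zey [LHS]addrC [y + e]addrC addrA.
    by move: zey; rewrite z0 add0r; apply: AB0.
(* The transform does not enlarge the sumset: (z + e) + y = (y + e) + z, and [y + e] lies in [A] for
   [y] in [B']. *)
rewrite ltnS; apply/subset_leq_card/fintype.subsetP => _ /imset2P[x y + + ->].
rewrite !inE => /orP[Ax|/imsetP[z Bz ->]] /andP[By Aye].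
  exact: imset2_f.
by apply/imset2P; exists (y + e) z => //; rewrite addrC addrA (addrAC y) -addrA.
Qed.

Definition sub_multiset t s := forall x, (count_mem x t <= count_mem x s)%N.

Definition zfree s :=
  forall t, sub_multiset t s -> \sum_(x <- t) x = 0 -> t = [::].

Fixpoint subsums s : {set T} :=
  if s is x :: s' then subsums s' :|: [set x + y | y in subsums s'] else [set 0].

Lemma subsums0 s : 0 \in subsums s.
Proof. by elim: s => [|x s IHs]; rewrite !inE ?IHs. Qed.

Lemma subsumsP s x : x \in subsums s ->
  exists2 t, sub_multiset t s & x = \sum_(y <- t) y.
Proof.
elim: s x => [|y s IHs] x /=.
  by rewrite inE => /eqP->; exists [::]; rewrite ?big_nil.
rewrite inE => /orP[/IHs[t ts ->]|/imsetP[z /IHs[t ts ->] ->]].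
  by exists t => // z; rewrite (leq_trans (ts z)) //= leq_addl.
by exists (y :: t) => [u|]; rewrite ?big_cons //= leq_add2l.
Qed.

Lemma zfree_perm s s' : perm_eq s s' -> zfree s -> zfree s'.
Proof. by move=> /seq.permP E zs t ts; apply: zs => x; rewrite E. Qed.

Lemma zfree_catr s s' : zfree (s ++ s') -> zfree s'.
Proof.
by move=> zs t ts; apply: zs => x; rewrite count_cat (leq_trans (ts x)) ?leq_addl.
Qed.

Lemma zfree_catl s s' : zfree (s ++ s') -> zfree s.
Proof.
by move=> zs t ts; apply: zs => x; rewrite count_cat (leq_trans (ts x)) ?leq_addr.
Qed.

(** Supplies the hypothesis of [moser_scherk] for two sets of subsums: the sequences summing to [a]
    and [b] concatenate to a zero-sum part of [s ++ s'], so both are empty. *)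
Lemma zfree_addN0 s s' a b :
  zfree (s ++ s') -> a \in subsums s -> b \in subsums s' -> a + b = 0 -> b = 0.
Proof.
move=> zs /subsumsP[t ts ->] /subsumsP[t' ts' ->]; rewrite -big_cat /= => /zs tt'.
suff: t ++ t' == [::].
  by rewrite -size_eq0 size_cat addn_eq0 => /andP[_ /eqP/size0nil ->]; rewrite big_nil.
by apply/eqP/tt' => x; rewrite !count_cat leq_add.
Qed.

Lemma zfree_oppN a s : zfree (a :: s) -> - a \notin subsums s.
Proof.
move=> zs; apply/negP=> as_.
have a0 : a \in subsums [:: a].
  by rewrite inE; apply/orP; right; apply/imsetP; exists 0; rewrite ?inE ?addr0.
have /eqP := @zfree_addN0 [:: a] s _ _ zs a0 as_ (subrr a).
rewrite oppr_eq0 => /eqP a00; have /zs : sub_multiset [:: a] (a :: s).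
  by move=> x /=; rewrite addn0 leq_addr.
by rewrite big_seq1 => /(_ a00).
Qed.

Lemma subsums_cat s s' :
  [set (a + b)%R | a in subsums s, b in subsums s'] = subsums (s ++ s').
Proof.
elim: s => [|x s IHs] /=.
  apply/setP=> z; apply/imset2P/idP => [[a b]|sz]; last by exists 0 z; rewrite ?inE ?add0r.
  by rewrite inE => /eqP-> sb ->; rewrite add0r.
rewrite -IHs; apply/setP=> z; apply/imset2P/setUP => [[a b]|].
  rewrite inE => /orP[sa sb ->|/imsetP[y sy ->] sb ->]; [left|right].
    exact: imset2_f.
  by rewrite -addrA; apply/imset_f/imset2_f.
case=> [/imset2P[a b sa sb ->]|/imsetP[y /imset2P[a b sa sb ->] ->]].
  by exists a b; rewrite // inE sa.
by exists (x + a) b; rewrite ?addrA // inE (imset_f (+%R x)) ?orbT.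
Qed.

Lemma card_subsums_cat s s' : zfree (s ++ s') ->
  (#|subsums s| + #|subsums s'| <= #|subsums (s ++ s')|.+1)%N.
Proof.
move=> zs; rewrite -subsums_cat; apply: moser_scherk; rewrite ?subsums0 //.
by move=> a b; apply: zfree_addN0.
Qed.

Lemma card_subsums1 a : a != 0 -> (#|subsums [:: a]| = 2)%N.
Proof.
move=> a0; rewrite /= imset_set1 addr0 cardsU1 cards1 inE.
by rewrite eq_sym a0.
Qed.

Lemma zfree_head_neq0 a s : zfree (a :: s) -> a != 0.
Proof.
by move/zfree_oppN; apply: contraNneq => ->; rewrite oppr0 subsums0.
Qed.

Lemma card_subsums2 a b : zfree [:: a; b] -> a != b ->
  (4 <= #|subsums [:: a; b]|)%N.
Proof.
move=> zab nab.
have a0 := zfree_head_neq0 zab; have b0 := zfree_head_neq0 (@zfree_catr [:: a] _ zab).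
have ab0 : a + b != 0.
  apply/eqP=> ab; have /zab := fun x => leqnn (count_mem x [:: a; b]).
  by rewrite big_cons big_seq1 => /(_ ab).
rewrite -[4%N]/(size [:: 0; a; b; a + b]) -(card_uniqP _); last first.
  rewrite /= !inE !negb_or !(eq_sym 0) a0 b0 ab0 nab /=.
  by rewrite -subr_eq0 opprD addNKr oppr_eq0 b0 -subr_eq0 opprD addrCA subrr addr0 oppr_eq0 a0.
apply/subset_leq_card/fintype.subsetP => x; rewrite !inE => xE.
rewrite /= !imsetU !imset_set1 !addr0 !inE.
by case/or4P: xE => /eqP ->; rewrite eqxx ?orbT.
Qed.

(* Peel off pairs of distinct elements as long as there are any: each pair
   contributes at least 3 to the number of subsums, instead of 2. *)
Lemma zfree_multiplicity s : zfree s -> exists g s',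
  perm_eq s s' /\ (3 * size s + 2 <= 2 * #|subsums s'| + count_mem g s)%N.
Proof.
have [m] := ubnP (size s); elim: m s => // m IHm s lesm zs.
case: s => [|g s] in lesm zs *.
  by exists 0, [::]; rewrite /= cards1.
(* A constant sequence of N terms has at least N + 1 subsums and multiplicity N, and 3N + 2 = 2(N +
   1) + N. *)
have [gall|/allPn[x sx /= gx]] := boolP (all (pred1 g) s).
  have gs : s = nseq (size s) g by apply/all_pred1P.
  exists g, (g :: s); split => //.
  have : ((size s).+2 <= #|subsums (g :: s)|)%N.
    rewrite gs in zs *; rewrite size_nseq; elim: (size s) zs => [|i IHi] zs.
      by rewrite card_subsums1 //; exact: zfree_head_neq0 zs.
    have zs' : zfree ([:: g] ++ nseq i.+1 g) by [].
    have := card_subsums_cat zs'.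
    rewrite card_subsums1; last exact: zfree_head_neq0 zs.
    by have := IHi (zfree_catr zs'); simpl; lia.
  by move: gall; rewrite all_count => /eqP /= ->; rewrite eqxx; lia.
have sE : perm_eq (g :: s) ([:: g; x] ++ rem x s) by rewrite /= perm_cons perm_to_rem.
have zs1 := zfree_perm sE zs.
have [||h [s' [ps' IH]]] := IHm (rem x s).
- by rewrite size_rem //; move: lesm => /=; lia.
- exact: zfree_catr zs1.
exists h, ([:: g; x] ++ s'); split.
  by rewrite (perm_trans sE) // perm_cat2l.
have zs2 : zfree ([:: g; x] ++ s') by apply: zfree_perm zs1; rewrite perm_cat2l.
(* The pair adds 2 to the size and at least 3 to the number of subsums, so 6 on the left and at
   least 6 on the right. *)
have := card_subsums_cat zs2.
have := card_subsums2 (zfree_catl zs2); rewrite eq_sym => /(_ gx).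
have /= := perm_size sE; have /= := seq.permP sE (pred1 h); move: IH => /=; lia.
Qed.

End ZeroSumFree.

(** * Structure of long zero-sum free sequences *)

Section Structure.
Variable T : finZmodType.
Implicit Types (a b g x : T) (s t : seq T).

Lemma mulrn_order g : g *+ #[g]%g = 0.
Proof. by rewrite -FinRing.zmodXgE expg_order. Qed.

Lemma zfree_nseq_order m g : zfree (nseq m g) -> (m < #[g]%g)%N.
Proof.
move=> zg; rewrite ltnNge; apply/negP=> le_om.
have /zg : sub_multiset (nseq #[g]%g g) (nseq m g).
  by move=> x; rewrite !count_nseq leq_mul2l le_om orbT.
rewrite big_nseq iter_addr_0 mulrn_order => /(_ erefl) /(congr1 size).
by rewrite size_nseq => /= og; have := order_gt0 g; rewrite og.
Qed.

(** The order of [g] divides [#|T|] and is at least m + 1, more than half of [#|T|], so the quotient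
    is 1. *)
Lemma zfree_nseq_generator m g :
  zfree (nseq m g) -> (#|T| <= m.*2.+1)%N -> generator [set: T] g.
Proof.
move=> /zfree_nseq_order lt_mo leTm.
have: (#[g]%g %| #|T|)%N by rewrite -cardsT order_dvdG ?inE.
have T0 : (0 < #|T|)%N by apply/card_gt0P; exists g.
case/dvdnP=> [[|[|q]] Tq]; [by rewrite Tq in T0 | | by lia].
have oT : #[g]%g = #|T| by rewrite Tq mul1n.
by rewrite /generator eq_sym eqEcard finset.subsetT cardsT -oT; exact: leqnn.
Qed.

Lemma generator_order_card g : generator [set: T] g -> #[g]%g = #|T|.
Proof. by move/eqP=> gT; rewrite -cardsT gT. Qed.

Lemma generator_dlog g : generator [set: T] g ->
  {c : T -> nat | forall x, (c x < #|T|)%N /\ x = g *+ c x}.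
Proof.
move=> gT; have gE : [set: T] = <[g]>%g by apply/eqP.
have c x : {i : nat | (i < #|T|)%N & x = g *+ i}.
  rewrite -(generator_order_card gT).
  have /cyclePmin[i lti xE] : x \in <[g]>%g by rewrite -gE inE.
  by exists i; rewrite // -FinRing.zmodXgE.
by exists (fun x => s2val (c x)) => x; case: (c x).
Qed.

Lemma subsums_nseq m g v : (v <= m)%N -> g *+ v \in subsums (nseq m g).
Proof.
elim: m v => [|m IHm] [|v] //= lev; first by rewrite inE mulr0n.
  by rewrite inE subsums0.
by rewrite inE mulrS [_ \in imset _ _]imset_f ?orbT ?IHm.
Qed.

(* With n = #|T|: the subsums of f and m copies of g are the multiples of g by
   an interval [0, M]. As -x is not among them, c x + M < n for a further
   element x, and c x <= m + 1 <= M + 1 leaves no gap after adding x. *)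
Lemma zfree_sum_dlog g (c : T -> nat) m f :
  (forall x, (c x < #|T|)%N /\ x = g *+ c x) -> g *+ #|T| = 0 ->
  (m < #|T| <= m.*2.+1)%N -> zfree (f ++ nseq m g) ->
  (m + \sum_(x <- f) c x < #|T|)%N /\
  forall v, (v <= m + \sum_(x <- f) c x)%N -> g *+ v \in subsums (f ++ nseq m g).
Proof.
move=> cE gT /andP[ltmT leTm]; elim: f => [|x f IHf] zf.
  by rewrite big_nil addn0; split=> // v; apply: subsums_nseq.
have [] := IHf (@zfree_catr _ [:: x] _ zf).
rewrite big_cons; set M := (m + _)%N => ltMT sumsM.
have [ltcT xE] := cE x.
have NxE : - x = g *+ (#|T| - c x).
  rewrite (mulrnBr g (ltnW ltcT)) gT sub0r; congr (- _); exact: xE.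
have ltM : (M < #|T| - c x)%N.
  by rewrite ltnNge; apply: contra (zfree_oppN zf); rewrite NxE; apply: sumsM.
have leM : (m <= M)%N by apply: leq_addr.
rewrite addnCA -/M; split=> [|v lev]; first by lia.
rewrite /= inE; have [|ltMv] := leqP v M; first by move/sumsM->.
have lecv : (c x <= v)%N by lia.
rewrite -(subnKC lecv) mulrnDr -xE.
by rewrite [_ \in imset _ _]imset_f ?orbT // sumsM //; lia.
Qed.

Lemma zfree_long_structure k s : zfree s ->
  size s = (#|T| - 1 - k)%N -> (6 * k + 1 < #|T|)%N ->
  exists g, [/\ generator [set: T] g, g \in s &
    forall x, x \in s -> x != g ->
      (count_mem x s <= k)%N /\ exists2 j, (j < k)%N & x = g *+ j.+2].
Proof.
move=> zs szs ltkT.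
have [g [s' [ss' les]]] := zfree_multiplicity zs.
have leST : (#|subsums s'| <= #|T|)%N by apply: max_card.
pose f := seq.filter (predC1 g) s; set m := count_mem g s in les.
have sE : perm_eq s (f ++ nseq m g).
  have -> : nseq m g = seq.filter (pred1 g) s.
    have /all_pred1P -> : all (pred1 g) (seq.filter (pred1 g) s) by apply: filter_all.
    by rewrite size_filter.
  by rewrite perm_sym perm_catC perm_filterC.
have zf := zfree_perm sE zs.
(* With n = [#|T|] bounding the number of subsums, [les] gives m >= 3(n - 1 - k) + 2 - 2n = n - 1 -
   3k, and n > 6k + 1 then gives n <= 2m + 1. *)
have leTm : (#|T| <= m.*2.+1)%N by lia.
have gT := zfree_nseq_generator (zfree_catr zf) leTm.
have [c cE] := generator_dlog gT.
have ltmT : (m < #|T|)%N.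
  by move: (zfree_nseq_order (zfree_catr zf)); rewrite (generator_order_card gT).
have gT0 : g *+ #|T| = 0 by rewrite -(generator_order_card gT) mulrn_order.
have [] := zfree_sum_dlog cE gT0 _ zf; first by rewrite ltmT.
move=> ltsum _.
have c_gt1 x : x \in f -> (1 < c x)%N.
  rewrite mem_filter => /andP[/= nxg sx]; have [_] := cE x.
  case: (c x) => [|[|//]] xE; last by rewrite xE eqxx in nxg.
  have /zs : sub_multiset [:: x] s.
    move=> y /=; rewrite addn0; have [<-|//] := eqVneq.
    by rewrite -has_count has_pred1.
  by rewrite big_seq1 xE => /(_ erefl).
have sz : (size s = size f + m)%N by rewrite (perm_size sE) size_cat size_nseq.
have sumf : (size f + \sum_(x <- f) (c x).-1 = \sum_(x <- f) c x)%N.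
  rewrite -sum1_size -big_split /=; apply: eq_big_seq => x /c_gt1.
  by case: (c x).
(* Since m + [size f] = n - 1 - k and m plus the sum of the [c x] is at most n - 1, the excesses
   [(c x).-1] total at most k. Each is at least 1, which bounds both the multiplicities and the
   coefficients. *)
have lek : (\sum_(x <- f) (c x).-1 <= k)%N.
  move: ltsum szs; rewrite -sumf sz; move: (size f) (bigop _ _ _); clear; lia.
exists g; split=> //.
  by rewrite -has_pred1 has_count; lia.
move=> x sx nxg; have fx : x \in f by rewrite mem_filter /= nxg.
split.
  apply: leq_trans lek; have -> : count_mem x s = count_mem x f.
    by rewrite (seq.permP sE) count_cat count_nseq /= eq_sym (negPf nxg) addn0.
  rewrite -sum1_count big_mkcond /= big_seq [leqRHS]big_seq; apply: leq_sum => y fy.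
  by have := c_gt1 _ fy; case: eqP => // _; case: (c y) => [|[]].
exists (c x).-2.
  have := c_gt1 _ fx; move: lek; rewrite (big_rem x fx) /=; lia.
by have [_ {1}->] := cE x; have := c_gt1 _ fx; case: (c x) => [|[]].
Qed.

End Structure.

(** * Counting the zero-sum free sequences contained in a set *)

Lemma sum_count_mem (T : finType) (V : nmodType) (f : T -> V) (s : seq T) :
  \sum_(x <- s) f x = \sum_x f x *+ count_mem x s.
Proof.
elim: s => [|y s IHs]; first by rewrite big_nil big1.
rewrite big_cons IHs (bigD1 y) // [in RHS](bigD1 y) //= eqxx mulrS -addrA.
congr (_ + (_ + _)); apply: eq_bigr => x /negPf nxy.
by rewrite eq_sym nxy.
Qed.

Lemma size_count_mem (T : finType) (s : seq T) :
  size s = (\sum_x count_mem x s)%N.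
Proof.
by rewrite -sum1_size sum_count_mem; apply: eq_bigr => x _; exact: natn.
Qed.

Section Counting.
Variables (T : finZmodType) (l : nat).
Implicit Types (S U : mseq T l) (A : {set T}) (g x : T).

Definition seq_of_mseq S : seq T := flatten [seq nseq (S x) x | x <- enum T].

Lemma count_seq_of_mseq S x : count_mem x (seq_of_mseq S) = S x.
Proof.
rewrite count_flatten -map_comp sumnE big_map big_enum /= (bigD1 x) //=.
rewrite count_nseq /= eqxx mul1n big1 ?addn0 // => y /negPf nyx.
by rewrite count_nseq /= nyx.
Qed.

Lemma mem_seq_of_mseq S x : (x \in seq_of_mseq S) = (0 < S x)%N.
Proof. by rewrite -has_pred1 has_count count_seq_of_mseq. Qed.

Lemma size_seq_of_mseq S : size (seq_of_mseq S) = mlength S.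
Proof. by rewrite size_count_mem; apply: eq_bigr => x _; rewrite count_seq_of_mseq. Qed.

Lemma zfree_seq_of_mseq S : zero_sum_free S -> zfree (seq_of_mseq S).
Proof.
move=> /existsPn zS t tS t0; pose U : mseq T l := [ffun x => inord (count_mem x t)].
(* [inord] truncates nothing: the multiplicities in [t] are bounded by those of [S], hence by
   [l]. *)
have UE x : U x = count_mem x t :> nat.
  rewrite ffunE inordK // ltnS; apply: leq_trans (tS x) _.
  by rewrite count_seq_of_mseq -ltnS.
have := zS U; have -> : subsequence U S.
  by apply/forallP=> x; rewrite UE (leq_trans (tS x)) ?count_seq_of_mseq.
have -> : zero_sum U.
  rewrite /zero_sum /msum; under eq_bigr do rewrite UE.
  by rewrite -sum_count_mem t0.
have -> : mlength U = size t.
  by rewrite size_count_mem; apply: eq_bigr => x _; rewrite UE.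
by case: t {tS t0 U UE}.
Qed.

Definition power_mseq g : mseq T l := [ffun x => if x == g then ord_max else ord0].

Lemma mlength_power_mseq g : mlength (power_mseq g) = l.
Proof.
rewrite /mlength (bigD1 g) //= ffunE eqxx big1 ?addn0 // => x /negPf nxg.
by rewrite ffunE nxg.
Qed.

(** A zero-sum part consists of i copies of [g] with 0 < i <= l, while the order [#|T|] of [g] would
    divide i. These sequences give the lower bound X <= N. *)
Lemma power_mseq_zero_sum_free g :
  (l < #|T|)%N -> generator [set: T] g -> zero_sum_free (power_mseq g).
Proof.
move=> ltlT gT; apply/existsPn => U; apply/negP=> /and3P[/forallP sU U0 /eqP].
have U0E x : x != g -> U x = 0 :> nat.
  by move=> /negPf nxg; have := sU x; rewrite ffunE nxg leqn0 => /eqP.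
move: U0; rewrite /mlength /msum (bigD1 g) // [in X in _ -> X](bigD1 g) //=.
rewrite big1 => [|x /U0E //]; rewrite addn0 big1 => [|x /U0E -> //].
rewrite addr0 => U0 /eqP; rewrite -FinRing.zmodXgE -[0]/(1%g : T) -order_dvdn.
move=> /(dvdn_leq U0); rewrite (generator_order_card gT) leqNgt.
by rewrite (leq_ltn_trans _ ltlT) // -ltnS.
Qed.

Lemma power_mseq_inj : (0 < l)%N -> injective power_mseq.
Proof.
move=> l0 g h /(congr1 (fun S : mseq T l => S g : nat)).
rewrite !ffunE eqxx; case: eqVneq => //= _ l0'.
by rewrite l0' in l0.
Qed.

Definition generators_in A := [set g in A | generator [set: T] g].

(** The pair {g, (j+2)g}; the index j < k stands for a coefficient between 2 and k + 1. *)
Definition progression k (u : T * 'I_k) : {set T} := [set u.1; u.1 *+ u.2.+2].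

Definition progressions_in k A :=
  [set u : T * 'I_k | (progression u \subset A) && generator [set: T] u.1].

Lemma generators_le_num_zsf A :
  (0 < l < #|T|)%N -> (#|generators_in A| <= num_zsf l A)%N.
Proof.
case/andP=> l0 ltlT; rewrite -(card_imset (generators_in A) (power_mseq_inj l0)).
apply/subset_leq_card/fintype.subsetP => _ /imsetP[g + ->].
rewrite !inE => /andP[gA gT]; rewrite mlength_power_mseq eqxx.
rewrite power_mseq_zero_sum_free //=; apply/forallP=> x; rewrite ffunE.
by case: eqVneq => [->|//]; rewrite gA implybT.
Qed.

(** Decodes a sequence: [w] gives the multiplicities of 2g, ..., (k+1)g, and copies of [g] fill up
    the length to [l]. *)
Definition mseq_of_progression k g (w : {ffun 'I_k -> 'I_k.+1}) : mseq T l :=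
  let h x : nat := if [pick i : 'I_k | x == g *+ i.+2] is Some i then w i else 0%N in
  [ffun x => inord (if x == g then l - \sum_(y | y != g) h y else h x)%N].

(* A sequence containing some x != g is recovered from g and from the
   multiplicities (at most k) of 2g, ..., (k+1)g. *)
Lemma num_zsf_le k A : (6 * k + 1 < #|T|)%N -> l = (#|T| - 1 - k)%N ->
  (num_zsf l A <= #|generators_in A| + #|progressions_in k A| * k.+1 ^ k)%N.
Proof.
move=> ltkT lE; pose C := [set: {ffun 'I_k -> 'I_k.+1}].
pose B := [set mseq_of_progression v.1.1 v.2 | v in finset.setX (progressions_in k A) C].
have cC : #|C| = (k.+1 ^ k)%N by rewrite cardsT card_ffun !card_ord.
rewrite -cC -cardsX; apply: (@leq_trans #|power_mseq @: generators_in A :|: B|); last first.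
  by apply: leq_trans (leq_card_setU _ _) _; rewrite leq_add ?leq_imset_card.
apply/subset_leq_card/fintype.subsetP => S; rewrite !inE => /and3P[/eqP lS zS /forallP SA].
have [|g [gT]] := zfree_long_structure (zfree_seq_of_mseq zS) _ ltkT.
  by rewrite size_seq_of_mseq lS.
rewrite mem_seq_of_mseq => Sg prog; have gA := implyP (SA g) Sg.
have Sprog x : (0 < S x)%N -> x != g -> (S x <= k)%N /\ exists j : 'I_k, x = g *+ j.+2.
  rewrite -mem_seq_of_mseq -count_seq_of_mseq => Sx /(prog _ Sx) [-> [j ltjk ->]].
  by split=> //; exists (Ordinal ltjk).
have SgE : S g = (l - \sum_(x | x != g) S x)%N :> nat.
  by have := lS; rewrite {1}/mlength (bigD1 g) //=; set m := (\sum_(x | _) _)%N => e; lia.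
(* Either a term x = (j+2)g other than [g] occurs, and [S] is encoded by (g, j) and its
   multiplicities, or [S] is [g] repeated [l] times. *)
have [/existsP[x /andP[Sx nxg]] | /existsPn Snil] :=
    boolP [exists x, (0 < S x)%N && (x != g)].
  apply/orP; right; have [_ [j xE]] := Sprog x Sx nxg.
  apply/imsetP; exists ((g, j), [ffun i : 'I_k => inord (S (g *+ i.+2))]).
    rewrite !inE /= gT !andbT; apply/fintype.subsetP => y; rewrite !inE => /orP[]/eqP-> //.
    by rewrite -xE; apply: (implyP (SA x)).
  apply/ffunP=> y; apply: val_inj; rewrite ffunE.
  (* Whichever index [pick] returns, the decoded value is the multiplicity of [z]; if it returns
     none, [z] does not occur in [S]. *)
  have hE z : z != g -> (if [pick i : 'I_k | z == g *+ i.+2] is Some i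
      then [ffun i : 'I_k => inord (S (g *+ i.+2)) : 'I_k.+1] i else 0)%N = S z :> nat.
    move=> nzg; case: pickP => [i /eqP zi|nz].
      rewrite ffunE -zi inordK //; have [->//|Sz] := posnP (S z).
      by rewrite ltnS; case: (Sprog z Sz nzg).
    have [->//|Sz] := posnP (S z).
    by have [_ [i /eqP]] := Sprog z Sz nzg; rewrite nz.
  rewrite /= (eq_bigr _ hE) -SgE; case: eqVneq => [->|/hE->]; by rewrite inordK.
apply/orP; left; apply/imsetP; exists g; first by rewrite inE gA.
have S0 x : x != g -> S x = 0 :> nat.
  by move=> nxg; have := Snil x; rewrite nxg andbT -eqn0Ngt => /eqP.
apply/ffunP=> x; apply: val_inj; rewrite ffunE; case: eqVneq => [->|/S0 //].
by apply: etrans SgE _; rewrite big1 ?subn0.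
Qed.

End Counting.

(** * Moments and Chebyshev's inequality for a random subset *)

Section RandomSubset.
Variables (R : realType) (T : finType) (p : R).
Hypothesis p01 : 0 <= p <= 1.
Implicit Types (A B : {set T}).

Definition weight A : R := \prod_(x : T) (if x \in A then p else 1 - p).

Lemma weight_ge0 A : 0 <= weight A.
Proof. by have /andP[p0 p1] := p01; apply: prodr_ge0 => x _; case: ifP => _; lra. Qed.

(** Write each factor of the power as p + 0 on [B] and p + (1 - p) off [B], then expand: the term of
    a set [A] missing a point of [B] vanishes, the others are the weights. *)
Lemma sum_weight_superset B : \sum_(A : {set T} | B \subset A) weight A = p ^+ #|B|.
Proof.
have -> : p ^+ #|B| = \prod_(x : T) (p + (if x \in B then 0 else 1 - p)).
  rewrite -prodr_const big_mkcond /=; apply: eq_bigr => x _.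
  by case: ifP => _; ring.
rewrite bigA_distr big_mkcond /=; apply: eq_bigr => A _.
case: ifPn => [/fintype.subsetP BA|/subsetPn[x Bx Ax]]; last first.
  by rewrite (bigD1 x) //= (negPf Ax) Bx mul0r.
apply: eq_bigr => x _; case: ifP => // /negbT Ax.
by rewrite ifN //; apply: contra Ax; apply: BA.
Qed.

Lemma sum_weight : \sum_(A : {set T}) weight A = 1.
Proof.
rewrite -[RHS](expr0 p) -(cards0 T) -sum_weight_superset.
by apply: eq_bigl => A; rewrite finset.sub0set.
Qed.

Lemma Pr_subset_le1 (E : pred {set T}) : Pr_subset p E <= 1.
Proof.
rewrite -[leRHS]sum_weight /Pr_subset big_mkcond /=; apply: ler_sum => A _.
by case: ifP; rewrite ?weight_ge0.
Qed.

Lemma Pr_subset_union_bound (E B1 B2 : pred {set T}) :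
  (forall A, ~~ B1 A -> ~~ B2 A -> E A) ->
  1 - (Pr_subset p B1 + Pr_subset p B2) <= Pr_subset p E.
Proof.
move=> EB; rewrite lerBlDr -[leLHS]sum_weight /Pr_subset.
rewrite (big_mkcond E) (big_mkcond B1) (big_mkcond B2) -!big_split /=; apply: ler_sum => A _.
have := weight_ge0 A; rewrite /weight; set w := \prod_(x : T) _ => w0.
by move: (EB A); case: (B1 A); case: (B2 A); case: (E A) => //= EBA; lra.
Qed.

Section SecondMoment.
Variables (I : finType) (P : pred I) (F : I -> {set T}) (K : nat).
Hypothesis meetK :
  forall i, P i -> (#|[pred j | P j && ~~ [disjoint F i & F j]]| <= K)%N.

Definition num_contained A : nat := #|[pred i | P i && (F i \subset A)]|.
Let mu : R := \sum_(i | P i) p ^+ #|F i|.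

Lemma num_containedE A : (num_contained A)%:R = \sum_(i | P i) (F i \subset A)%:R :> R.
Proof.
rewrite /num_contained -sum1_card natr_sum big_mkcondr /=; apply: eq_bigr => i _.
by case: (F i \subset A).
Qed.

Lemma mean_num_contained : \sum_A weight A * (num_contained A)%:R = mu.
Proof.
under eq_bigr do rewrite num_containedE mulr_sumr.
rewrite exchange_big; apply: eq_bigr => i _ /=.
rewrite -sum_weight_superset [RHS]big_mkcond; apply: eq_bigr => A _.
by case: ifP => _; rewrite ?mulr1 ?mulr0.
Qed.

Lemma moment2_num_contained :
  \sum_A weight A * (num_contained A)%:R ^+ 2 =
  \sum_(i | P i) \sum_(j | P j) p ^+ #|F i :|: F j|.
Proof.
under eq_bigr do rewrite num_containedE expr2 mulr_sumr mulr_sumr.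
rewrite exchange_big; apply: eq_bigr => i _ /=.
under eq_bigr do rewrite mulr_suml mulr_sumr.
rewrite exchange_big; apply: eq_bigr => j _ /=.
rewrite -sum_weight_superset [RHS]big_mkcond; apply: eq_bigr => A _.
rewrite finset.subUset.
by case: (_ \subset A); case: (_ \subset A); rewrite ?(mulr1, mulr0, mul0r).
Qed.

(** Disjoint [F i] and [F j] have covariance 0. For each i, at most [K] indices j remain, each
    contributing at most [p ^+ #|F i :|: F j| <= p ^+ #|F i|]. *)
Lemma variance_num_contained :
  \sum_A weight A * ((num_contained A)%:R - mu) ^+ 2 <= K%:R * mu.
Proof.
have -> : \sum_A weight A * ((num_contained A)%:R - mu) ^+ 2 =
    \sum_A weight A * (num_contained A)%:R ^+ 2 - mu ^+ 2.
  transitivity (\sum_A (weight A * (num_contained A)%:R ^+ 2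
      - 2 * mu * (weight A * (num_contained A)%:R) + mu ^+ 2 * weight A)).
    by apply: eq_bigr => A _; ring.
  rewrite big_split sumrB -!mulr_sumr mean_num_contained sum_weight /=; ring.
rewrite moment2_num_contained expr2 {1}/mu mulr_suml -sumrB mulr_sumr.
apply: ler_sum => i Pi; rewrite mulr_sumr -sumrB.
apply: (@le_trans _ _ (\sum_(j | P j && ~~ [disjoint F i & F j]) p ^+ #|F i|)).
  rewrite [leRHS]big_mkcondr /=; apply: ler_sum => j Pj.
  have [/andP[p0 p1] dFij] := (p01, cardsUI (F i) (F j)).
  case: ifPn => [_|/negPn]; last first.
    rewrite -setI_eq0 => /eqP Fij0; rewrite Fij0 cards0 addn0 in dFij.
    by rewrite dFij exprD subrr.
  rewrite lerBlDr; apply: ler_wpDr; first by rewrite mulr_ge0 ?exprn_ge0.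
  by apply: ler_wiXn2l => //; apply/subset_leq_card/finset.subsetUl.
rewrite sumr_const -[leLHS]mulr_natl ler_wpM2r ?exprn_ge0 //; first by case/andP: p01.
by rewrite ler_nat meetK.
Qed.

Lemma chebyshev_num_contained t : 0 <= t ->
  Pr_subset p (fun A => t < `|(num_contained A)%:R - mu|) * t ^+ 2 <= K%:R * mu.
Proof.
move=> t0; apply: le_trans variance_num_contained.
rewrite /Pr_subset mulr_suml big_mkcond /=; apply: ler_sum => A _.
case: ifP => [lt|_]; last by rewrite mulr_ge0 ?weight_ge0 ?sqr_ge0.
rewrite ler_wpM2l ?weight_ge0 //  -[leRHS]real_normK ?num_real //.
by rewrite lerXn2r ?nnegrE ?normr_ge0 // ltW.
Qed.

End SecondMoment.
End RandomSubset.

(** * Pairs {g, (j+2)g} meeting a given one *)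

Section Families.
Variables (T : finZmodType) (k : nat).
Implicit Types (A : {set T}) (g x : T).

(** On the fiber the residue of a c(y) modulo n = [#|T|] is fixed, so y is determined by the
    quotient of a c(y) by n, which takes at most a values. *)
Lemma card_mulrn_fiber g x a : (0 < a)%N -> generator [set: T] g ->
  (#|[pred y : T | y *+ a == x]| <= a)%N.
Proof.
move=> a0 gT; have [c cE] := generator_dlog gT.
have T0 : (0 < #|T|)%N by apply/card_gt0P; exists g.
have oT0 : g *+ #|T| = 0 by rewrite -(generator_order_card gT) mulrn_order.
pose r y := ((a * c y) %% #|T|)%N; pose q y := ((a * c y) %/ #|T|)%N.
have gr y : g *+ r y = y *+ a.
  rewrite [in RHS](cE y).2 -mulrnA [(c y * a)%N]mulnC [in RHS](divn_eq (a * c y) #|T|).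
  by rewrite mulrnDr mulnC mulrnA oT0 mul0rn add0r.
have lqa y : (q y < a)%N by rewrite ltn_divLR // ltn_pmul2l ?(cE y).1.
rewrite -[leqRHS]card_ord.
apply: (@leq_card_in _ _ (fun y => Ordinal (lqa y))) => // y z /eqP ya /eqP za [eq_q].
suff : (a * c y = a * c z)%N.
  by move=> /eqP; rewrite eqn_pmul2l // => /eqP cyz; rewrite (cE y).2 (cE z).2 cyz.
have : g *+ r y = g *+ r z by rewrite !gr ya za.
rewrite -!FinRing.zmodXgE => /eqP; rewrite eq_expg_mod_order (generator_order_card gT).
rewrite !modn_mod => /eqP rr.
by rewrite (divn_eq (a * c y) #|T|) (divn_eq (a * c z) #|T|) rr -/(q y) eq_q.
Qed.

(** Choose the common point x among at most 2 and the index j among k. Then g = x, or (j+2)g = x,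
    which has at most j + 2 <= k + 1 solutions: k + 2 choices in all. *)
Lemma progressions_meeting (u : T * 'I_k) : generator [set: T] u.1 ->
  (#|[pred v : T * 'I_k | generator [set: T] v.1 &&
        ~~ [disjoint progression u & progression v]]| <= k * (2 * k.+2))%N.
Proof.
move=> gT; rewrite -sum1_card.
pose f x (v : T * 'I_k) := ((v.1 == x) + (v.1 *+ v.2.+2 == x))%N.
apply: (@leq_trans (\sum_(v : T * 'I_k) \sum_(x in progression u) f x v)%N).
  rewrite big_mkcond leq_sum // => v _; case: ifP => // /andP[_].
  case/pred0Pn => x /= /andP[ux]; rewrite (bigD1 x ux) /= !inE /f.
  by case/orP=> /eqP->; rewrite eqxx; set b := nat_of_bool (_ == _); lia.
rewrite exchange_big /=.
apply: (@leq_trans (\sum_(x in progression u) k * k.+2)%N); last first.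
  rewrite sum_nat_const cards2 mulnCA leq_mul2l.
  by case: (_ != _); rewrite ?orbT // leq_mul2r ?orbT.
apply: leq_sum => x _; rewrite -(pair_bigA _ (fun g j => f x (g, j))) exchange_big /=.
rewrite -[k in (_ <= k * _)%N]card_ord -sum_nat_const; apply: leq_sum => j _.
have sumE (Q : pred T) : (\sum_g Q g = #|Q|)%N by rewrite -sum1_card [RHS]big_mkcond.
rewrite /f /= big_split /= -[k.+2]add1n leq_add //; first by rewrite (sumE (pred1 x)) card1.
rewrite (sumE [pred g | g *+ j.+2 == x]).
by apply: leq_trans (card_mulrn_fiber x _ gT) _; rewrite ?ltnS.
Qed.

End Families.

(** * Concentration for a fixed group *)

Section Concentration.
Variables (R : realType) (T : finZmodType) (k : nat) (p L : R).
Let Phi := #|[pred g : T | generator [set: T] g]|.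
Let C : R := (k.+1 ^ k)%N%:R.
Hypotheses (p0 : 0 < p) (p1 : p <= 1) (L0 : 0 < L).
Hypotheses (ltkT : (6 * k + 1 < #|T|)%N) (Phi0 : (0 < Phi)%N).

Lemma sum_pexp_card_singleton :
  \sum_(g : T | generator [set: T] g) p ^+ #|[set g]%SET| = p * Phi%:R.
Proof.
under eq_bigr do rewrite cards1 expr1.
by rewrite sumr_const mulr_natr.
Qed.

Lemma sum_pexp_card_progression :
  \sum_(u : T * 'I_k | generator [set: T] u.1) p ^+ #|progression u| =
  (Phi * k)%:R * p ^+ 2.
Proof.
rewrite (eq_bigr (fun=> p ^+ 2)) => [|u gT]; last first.
  (* The pair has two elements because 1 and j + 2 <= k + 1 are distinct modulo the order of the
     generator. *)
  rewrite cards2 -{1}[u.1]mulr1n; suff -> : u.1 *+ 1 != u.1 *+ u.2.+2 by [].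
  rewrite -!FinRing.zmodXgE eq_expg_mod_order (generator_order_card gT).
  by have ltu := ltn_ord u.2; rewrite !modn_small //; lia.
rewrite (eq_bigl (mem [pred u : T * 'I_k | generator [set: T] u.1])) //.
rewrite sumr_const -[LHS]mulr_natl; congr (GRing.natmul 1 _ * _).
rewrite -[X in (_ * X)%N]card_ord -cardX; apply: eq_card => u.
by rewrite !inE andbT.
Qed.

Lemma num_zsf_concentration :
  1 - (1 + (k * (2 * k.+2) * k)%:R) / L ^+ 2 <=
  Pr_subset p (fun A : {set T} =>
    `|(num_zsf (#|T| - 1 - k) A)%:R - p * Phi%:R| <=
      (1 + C * k%:R + C) * (p ^+ 2 * Phi%:R + Num.sqrt (p * Phi%:R) * L)).
Proof.
have p01 : 0 <= p <= 1 by rewrite ltW.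
have PhiR : 0 < Phi%:R :> R by rewrite ltr0n.
have pPhi0 : 0 < p * Phi%:R by rewrite mulr_gt0.
set t := Num.sqrt (p * Phi%:R) * L.
have t0 : 0 < t by rewrite mulr_gt0 ?sqrtr_gt0.
have tE : t ^+ 2 = p * Phi%:R * L ^+ 2 by rewrite exprMn sqr_sqrtr ?ltW.
have meet1 (g : T) : generator [set: T] g ->
    (#|[pred h : T | generator [set: T] h && ~~ [disjoint [set g]%SET & [set h]%SET]]| <= 1)%N.
  move=> _; rewrite -(card1 g); apply/subset_leq_card/fintype.subsetP => h.
  by rewrite !inE => /andP[_]; rewrite disjoints1 inE negbK eq_sym.
have cheb1 := chebyshev_num_contained p01 meet1 (ltW t0).
have cheb2 := chebyshev_num_contained p01 (@progressions_meeting T k) (ltW t0).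
rewrite sum_pexp_card_singleton mul1r in cheb1.
rewrite sum_pexp_card_progression in cheb2.
set B1 : pred {set T} := (fun A => _) in cheb1.
set B2 : pred {set T} := (fun A => _) in cheb2.
apply: le_trans (Pr_subset_union_bound p01 (B1 := B1) (B2 := B2) _); last first.
  (* Off both bad events, X is within t of p Phi and Y <= k p^2 Phi + t, so N - p Phi lies between
     -t and t + C (k p^2 Phi + t). *)
  move=> A; rewrite /B1 /B2 -!leNgt.
  have -> : num_contained (generator [set: T]) (fun g : T => [set g]%SET) A = #|generators_in A|.
    by apply: eq_card => g; rewrite !inE finset.sub1set andbC.
  have -> : num_contained (fun u : T * 'I_k => generator [set: T] u.1) (@progression T k) A
      = #|progressions_in k A|.
    by apply: eq_card => u; rewrite !inE andbC.
  set X := #|generators_in A|; set Y := #|progressions_in k A|.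
  set N := num_zsf _ A => X1 Y1.
  have NX : X%:R <= N%:R :> R.
    by rewrite ler_nat generators_le_num_zsf //; lia.
  have NXY : N%:R <= X%:R + Y%:R * C :> R.
    by rewrite -natrM -natrD ler_nat num_zsf_le.
  have C0 : 0 <= C by [].
  move: X1 Y1; rewrite !ler_norml natrM => /andP[X1 X2] /andP[Y1 Y2].
  have k0 : 0 <= k%:R :> R by [].
  have YC : Y%:R * C <= (t + Phi%:R * k%:R * p ^+ 2) * C by rewrite ler_wpM2r //; lra.
  have h1 : 0 <= C * t by rewrite mulr_ge0 // ltW.
  have h2 : 0 <= p ^+ 2 * Phi%:R by rewrite mulr_ge0 // ?sqr_ge0.
  have h3 : 0 <= C * k%:R * t by apply: mulr_ge0; [exact: mulr_ge0 | exact: ltW].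
  have h4 : 0 <= C * (p ^+ 2 * Phi%:R) by apply: mulr_ge0.
  have h5 : 0 <= C * k%:R * (p ^+ 2 * Phi%:R) by apply: mulr_ge0 => //; exact: mulr_ge0.
  by apply/andP; split; lra.
(* As t^2 = p Phi L^2, the event [B1] has probability at most 1 / L^2; for [B2], the mean k p^2 Phi
   is at most k p Phi, whence k times the meeting bound over L^2. *)
rewrite lerD2l lerN2 ler_pdivlMr ?exprn_gt0 //.
rewrite -(ler_pM2r pPhi0) -mulrA [L ^+ 2 * _]mulrC -tE mulrDl mulrDl mul1r.
apply: lerD => //; apply: le_trans cheb2 _.
rewrite [leRHS](_ : _ = (k * (2 * k.+2))%:R * ((Phi * k)%:R * p)).
  by rewrite !ler_wpM2l // expr2 ler_piMr // ltW.
by rewrite !natrM; ring.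
Qed.

End Concentration.

(** * The limit as n tends to infinity *)

Local Open Scope classical_set_scope.

Lemma Dk_gt0 (R : realType) k : (0 < Dk R k)%N.
Proof.
rewrite /Dk truncn_gt0 ler_pdivlMr // mul1r -[leLHS]/(1 + 1) lerD2l.
by rewrite -{1}(@sqrtr1 R) ler_sqrt ?lerDl ?addr_ge0 ?mulr_ge0.
Qed.

Theorem theorem4 (R : realType) (k : nat) :
  let D := Dk R k in
  exists c : R, forall p : nat -> R,
    (forall n, 0 <= p n <= 1) ->
    much_less (fun n => ln n%:R ^+ (2 * D) * ln (ln n%:R) / n%:R) p ->
    much_less p (fun _ => 1) ->
    Pr_subset (p n) (fun A : {set 'Z_n} =>
      `|(num_zsf (n - 1 - k) A)%:R - p n * (phi n)%:R| <=
        c * (p n ^+ 2 * (phi n)%:R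
             + Num.sqrt (p n * (phi n)%:R) * ln n%:R ^+ D))
      @[n --> \oo] --> (1 : R).
Proof.
move=> D; pose C : R := (k.+1 ^ k)%N%:R.
exists (1 + C * k%:R + C) => p p01 [pneq0 _] _.
pose M : R := 1 + (k * (2 * k.+2) * k)%:R.
have D0 : (0 < D)%N := Dk_gt0 R k.
have lnoo : ln (n%:R : R) @[n --> \oo] --> +oo.
  apply/cvgryPge => A; near=> n; rewrite -[A]expRK ler_ln ?posrE ?expR_gt0 //.
    by near: n; exact: nbhs_infty_ger.
  by rewrite ltr0n; near: n; exact: nbhs_infty_gt.
(* The error is M / (ln n)^(2D); it is at most M / ln n once ln n >= 1, because D >= 1. *)
have lb : 1 - M / ln (n%:R : R) @[n --> \oo] --> (1 : R).
  rewrite -[X in _ --> X]subr0 -[X in 1 - X](mulr0 M).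
  apply: cvgB; first exact: cvg_cst.
  apply: cvgM; first exact: cvg_cst.
  apply/gtr0_cvgV0 => //; near=> n.
  by apply: (@lt_le_trans _ _ 1) => //; near: n; move/cvgryPge : lnoo; apply.
apply: (@squeeze_cvgr _ _ _ R (fun n => 1 - M / ln n%:R) (fun=> 1) _ _ 1 lb);
  last exact: cvg_cst.
near=> n.
have ltkn : (6 * k + 2 < n)%N by near: n; exact: nbhs_infty_gt.
have ln1 : 1 <= ln (n%:R : R) by near: n; move/cvgryPge : lnoo; apply.
rewrite Pr_subset_le1 // andbT.
have n1 : (1 < n)%N by lia.
have cardZ : #|'Z_n| = n by rewrite card_ord Zp_cast.
(* Positivity for large n comes from the first conjunct of [much_less], that p n is eventually
   nonzero. *)
have pn0 : 0 < p n.
  rewrite lt_neqAle eq_sym; case/andP: (p01 n) => -> _; rewrite andbT.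
  by near: n.
have [_ pn1] := andP (p01 n).
have L0 : 0 < ln (n%:R : R) ^+ D by rewrite exprn_gt0 // (lt_le_trans ltr01).
have phi0 : (0 < phi n)%N by rewrite phiE // totient_gt0; lia.
have ltkT : (6 * k + 1 < #|'Z_n|)%N by rewrite cardZ; lia.
have := num_zsf_concentration pn0 pn1 L0 ltkT phi0.
rewrite cardZ; apply: le_trans.
rewrite lerD2l lerN2 ler_wpM2l ?addr_ge0 //.
rewrite lef_pV2 ?posrE ?exprn_gt0 ?(lt_le_trans ltr01) //.
rewrite -exprM -{1}[ln _]expr1 ler_weXn2l //; lia.
Unshelve. all: by end_near. Qed.
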